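(* Let $\|\cdot\|$ be any norm on $\ell_\infty^{c,F}(\omega_1)$ equivalent to the supremum norm $\|\cdot\|_\infty$. Then $(\ell_\infty^{c,F}(\omega_1),\|\cdot\|)$ contains an isometric copy of $(\ell_\infty^{c,F}(\omega_1),\|\cdot\|_\infty)$; that is, there is a linear map $J\colon \ell_\infty^{c,F}(\omega_1)\to\ell_\infty^{c,F}(\omega_1)$ with $\|Jx\|=\|x\|_\infty$ for all $x$.
   Context: All spaces are real. For a set $\Gamma$, $\ell_\infty^c(\Gamma)$ is the Banach space of all bounded functions $x\colon\Gamma\to\mathbb{R}$ whose support $\{\gamma\in\Gamma\colon x(\gamma)\neq0\}$ is at most countable, with the supremum norm $\|\cdot\|_\infty$. $\ell_\infty^{c,F}(\Gamma)$ is its dense linear subspace of those functions that take only finitely many values. $\omega_1$ is the first uncountable ordinal. *)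

(* Defs.v *)
From HB Require Import structures.
From mathcomp Require Import all_boot all_order all_algebra.
From mathcomp Require Import all_classical all_reals all_analysis.
From mathcomp Require Import wochoice.

Set Implicit Arguments.
Unset Strict Implicit.
Unset Printing Implicit Defensive.

Import Order.TTheory GRing.Theory Num.Theory.
Import numFieldNormedType.Exports.

Local Open Scope classical_set_scope.
Local Open Scope ring_scope.

(** * The first uncountable ordinal

  Fix a well-order of the uncountable type [set nat].  The points with only
  countably many predecessors form an uncountable initial segment all of whose
  proper initial segments are countable, i.e. a well-ordered set of order type
  omega_1; see [omega1_well_order], [omega1_segment_countable] and
  [omega1_uncountable]. *)

Definition wo_set_nat : rel (set nat) :=
  sval (well_ordering_principle (set nat)).

Definition omega1_set : set (set nat) :=
  [set a | countable [set b | wo_set_nat b a]].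

Definition omega1 : Type := set_type omega1_set.

Definition omega1_le (x y : omega1) : bool := wo_set_nat (val x) (val y).

Lemma wo_set_nat_min (A : set (set nat)) :
  A !=set0 -> exists a, A a /\ forall b, A b -> wo_set_nat a b.
Proof.
move=> [a Aa]; have h := svalP (well_ordering_principle (set nat)).
have [|z [[zA lz] _]] := h (mem A); first by exists a; apply/mem_set.
exists z; split; first exact: set_mem.
by move=> b Ab; apply: lz; apply/mem_set.
Qed.

Lemma wo_set_nat_anti a b : wo_set_nat a b -> wo_set_nat b a -> a = b.
Proof.
move=> ab ba; have h := svalP (well_ordering_principle (set nat)).
have rf c : wo_set_nat c c.
  by have [|_ [-> /(_ c erefl)]] := @wo_set_nat_min [set c]; first by exists c.
have [|z [_ uz]] := h (mem [set a; b]).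
  by exists a; apply/mem_set; left.
have <- : z = a.
  apply: uz; split; first by apply/mem_set; left.
  by move=> x /set_mem[] ->; [exact: rf|exact: ab].
apply: uz; split; first by apply/mem_set; right.
by move=> x /set_mem[] ->; [exact: ba|exact: rf].
Qed.

Lemma wo_set_nat_trans a b c :
  wo_set_nat a b -> wo_set_nat b c -> wo_set_nat a c.
Proof.
move=> ab bc.
have [|z [zA lz]] := @wo_set_nat_min [set a; b; c].
  by exists a; left; left.
case: zA lz => [[]|] -> lz.
- by apply: lz; right.
- have /(wo_set_nat_anti ab) -> : wo_set_nat b a by apply: lz; left; left.
  by [].
- have cb : wo_set_nat c b by apply: lz; left; right.
  by rewrite (wo_set_nat_anti cb bc).
Qed.

Lemma set_nat_uncountable : ~ countable [set: set nat].
Proof.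
move=> /countable_injP[f finj].
pose D := [set n | exists A, f A = n /\ ~ A n].
have nD : ~ D (f D).
  move=> /[dup] DfD [A [/finj fA nA]]; apply: nA.
  by rewrite fA// inE.
by apply: (nD); exists D.
Qed.

Lemma omega1_well_order : well_order omega1_le.
Proof.
apply: antisymmetric_well_order.
  by move=> x y /andP[xy yx]; apply: val_inj; exact: wo_set_nat_anti.
move=> A [x Ax].
have [|z [[y Ay <-] lz]] := @wo_set_nat_min (val @` [set y | y \in A]).
  by exists (val x), x.
exists y; split=> // t At; apply: lz.
by exists t.
Qed.

Lemma omega1_segment_countable (x : omega1) : countable [set y | omega1_le y x].
Proof.
have /set_mem /countable_injP[f finj] := valP x.
apply/countable_injP; exists (f \o val) => y z /set_mem yx /set_mem zx fyz.
by apply: val_inj; apply: finj fyz; apply/mem_set.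
Qed.

Lemma omega1_uncountable : ~ countable [set: omega1].
Proof.
move=> cT.
have cO : countable omega1_set.
  apply: sub_countable cT.
  apply: card_le_trans (card_image_le val [set: omega1]).
  apply: subset_card_le => a Oa.
  by exists (exist _ a (mem_set Oa)).
have [|a [nOa amin]] := @wo_set_nat_min (~` omega1_set).
  apply: contrapT => nO; apply: set_nat_uncountable.
  apply: sub_countable cO; apply: subset_card_le => b _.
  by apply: contrapT => nOb; apply: nO; exists b.
apply: nOa; apply: (@sub_countable _ _ _ (omega1_set `|` [set a])).
  apply: subset_card_le => b ba; have [Ob|nOb] := pselect (omega1_set b).
    by left.
  by right; apply: wo_set_nat_anti => //; exact: amin.
by rewrite -bigcup2E; apply: bigcup_countable => // -[|[|?]] _ /=.
Qed.

Definition linf_c_set (R : realType) (G : Type) : set (G -> R) :=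
  [set x | bounded_fun x /\ countable [set g | x g != 0]].

Definition linf_cF_set (R : realType) (G : Type) : set (G -> R) :=
  [set x | linf_c_set x /\ finite_set (range x)].

Section linf_cF.
Context (R : realType) (G : Type).

Definition linf_cF_pred : {pred G -> R} := mem (@linf_cF_set R G).

Lemma linf_cF_submod_closed : submod_closed linf_cF_pred.
Proof.
split.
  apply/mem_set; split; last first.
    by apply: sub_finite_set (finite_set1 (0 : R)) => _ [g _ <-].
  split.
    by exists 0; split=> // M M0 g _ /=; rewrite normr0 ltW.
  by rewrite (_ : [set g | _] = set0)//; apply/seteqP; split=> g //=; rewrite eqxx.
move=> a x y /set_mem[[[M [Mr xM]] cx] fx] /set_mem[[[N [Nr yN]] cy] fy].
apply/mem_set; split; last first.
  apply: (@finite_image11 G R R R setT (fun u v => a * u + v) x y fx fy).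
split.
  exists (`|a| * (M + 1) + (N + 1)); split; first exact: num_real.
  move=> K MNK g _ /=; apply: le_trans (ltW MNK).
  rewrite (le_trans (ler_normD _ _))// lerD//; last by apply: yN; rewrite ?ltrDl.
  by rewrite normrM ler_wpM2l//; apply: xM; rewrite ?ltrDl.
apply: (@sub_countable _ _ _ ([set g | x g != 0] `|` [set g | y g != 0])).
  apply: subset_card_le => g /= h.
  have [x0|] := eqVneq (x g) 0; last by left.
  right=> /=; apply: contraNneq h => y0.
  by rewrite /= [X in X == _](_ : _ = a * x g + y g)// x0 y0 mulr0 addr0.
by rewrite -bigcup2E; apply: bigcup_countable => // -[|[|?]] _ /=.
Qed.

HB.instance Definition _ := GRing.isSubmodClosed.Build _ _ linf_cF_pred
  linf_cF_submod_closed.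

Record linf_cF := LinfcF {
  linf_cF_fun :> G -> R;
  _ : linf_cF_fun \in linf_cF_pred }.

HB.instance Definition _ := [isSub for linf_cF_fun].
HB.instance Definition _ := [Choice of linf_cF by <:].
HB.instance Definition _ := [SubChoice_isSubLmodule of linf_cF by <:].

Definition sup_norm (x : linf_cF) : R := sup (range (fun g => `|x g|)).

End linf_cF.

Record is_norm (R : realType) (V : lmodType R) (N : V -> R) : Prop := IsNorm {
  is_norm_ge0 : forall x, 0 <= N x;
  is_norm_eq0 : forall x, N x = 0 -> x = 0;
  is_normZ : forall (a : R) x, N (a *: x) = `|a| * N x;
  is_normD : forall x y, N (x + y) <= N x + N y }.

Definition equivalent_norms (R : realType) (V : lmodType R) (N1 N2 : V -> R) :=
  exists c C : R, [/\ 0 < c, 0 < C &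
    forall x, c * N2 x <= N1 x /\ N1 x <= C * N2 x].

Lemma sup_norm_ub (R : realType) (G : Type) (x : linf_cF R G) g :
  `|x g| <= sup_norm x.
Proof.
apply: ub_le_sup; last by exists g.
case: x => x /= /set_mem[[[M [_ xM]] _] _].
by exists (M + 1) => _ [h _ <-]; apply: xM; rewrite ?ltrDl.
Qed.

(* Holds for empty [G] too, as [sup set0 = 0]. *)
Lemma sup_norm_is_norm (R : realType) (G : Type) : is_norm (@sup_norm R G).
Proof.
have [G0|nG0] := pselect (exists g : G, True); last first.
  have z (x : linf_cF R G) : sup_norm x = 0.
    rewrite /sup_norm (_ : [set `|x g| | g in _] = set0) ?sup0//.
    by apply/seteqP; split=> t // [g]; case: nG0; exists g.
  split=> [x|x _|a x|x y]; rewrite ?z ?mulr0 ?addr0//.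
  by apply/val_inj/funext => g; case: nG0; exists g.
have ge0 (x : linf_cF R G) : 0 <= sup_norm x.
  by have [g _] := G0; exact: le_trans (sup_norm_ub x g).
have le (x : linf_cF R G) M : (forall g, `|x g| <= M) -> sup_norm x <= M.
  have [g0 _] := G0 => xM; apply: ge_sup; first by exists `|x g0|, g0.
  by move=> _ [g _ <-].
have leZ a (x : linf_cF R G) : sup_norm (a *: x) <= `|a| * sup_norm x.
  by apply: le => g; rewrite normrM ler_wpM2l// sup_norm_ub.
split=> // [x x0|a x|x y].
- apply/val_inj/funext => g; apply/eqP; rewrite -normr_le0 -x0.
  exact: sup_norm_ub.
- apply/eqP; rewrite eq_le leZ /=.
  have [->|a0] := eqVneq a 0; first by rewrite normr0 mul0r.
  rewrite -ler_pdivlMl ?normr_gt0// -normfV.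
  by rewrite -{1}(scalerK a0 x); exact: leZ.
- apply: le => g; rewrite (le_trans (ler_normD _ _))//.
  by rewrite lerD ?sup_norm_ub.
Qed.

(* Main.v *)
(* The vectors with values in {0, 1, -1} are stable under pointwise limits of
   extensions, so an exhaustion argument works although the space is not
   complete: starting from 0 and extending infinitely often to a nearly maximal
   norm, the reflection z |-> 2 y - z, which exchanges the extensions of y,
   shows that the extensions of the limit x all have the same norm.
   Let M be the least K such that, off some countable set, all sign vectors have
   norm at most K; it is attained for a countable A0.  If y is disjoint from
   x, then x + y and x - y both have norm N x, so N y <= N x; hence N x = M when
   x lives off A0.  Transfinite recursion gives disjoint sign vectors X_b,
   b < omega_1, off A0 with N (X_b) = M.  Finitely valued vectors of the unit
   ball are convex combinations of sign vectors, so sums of a_b X_b with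
   |a_b| <= 1 have norm at most M, and reflecting such a sum v through
   a_b X_b gives 2 |a_b| M <= N v + M.  Hence J x = M^-1 sum_b x_b X_b is an
   isometry. *)
From HB Require Import structures.
Require Import Defs.
From mathcomp Require Import all_boot all_order all_algebra.
From mathcomp Require Import all_classical all_reals all_analysis.
From mathcomp Require Import lra.

Import Order.TTheory GRing.Theory Num.Theory.
Local Open Scope ring_scope.
Local Open Scope classical_set_scope.

(** * Sign vectors, extensions and reflections *)

Lemma countable_setU {T : Type} (A B : set T) :
  countable A -> countable B -> countable (A `|` B).
Proof.
by move=> cA cB; rewrite -bigcup2E; apply: bigcup_countable => // -[|[|?]] _ /=.
Qed.

Section Vectors.
Context {R : realType} {G : Type}.
Local Notation V := (linf_cF R G).
Implicit Types (A : set G) (x y z u : V).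

Lemma linf_cF_ext x y : x =1 y -> x = y.
Proof. by move=> xy; apply/val_inj/funext. Qed.

Lemma linf_cF_finite x : finite_set (range x).
Proof. by have /set_mem[] := valP x. Qed.

Definition support x : set G := [set g | x g != 0].

Lemma countable_support x : countable (support x).
Proof. by have /set_mem[[]] := valP x. Qed.

Lemma finite_range_linf_cF (f : G -> R) :
  countable [set g | f g != 0] -> finite_set (range f) ->
  f \in linf_cF_pred (R := R) (G := G).
Proof.
move=> cf ff; apply/mem_set; split=> //; split=> //.
have [s sE] := (finite_seqP (range f)).1 ff.
(* The sum of the absolute values of the finitely many values bounds each of them. *)
exists (\sum_(t <- s) `|t|); split; first exact: num_real.
move=> K sK g _ /=; apply: le_trans (ltW sK).
have /= : [set` s] (f g) by rewrite -sE; exists g.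
elim: s {sE sK} => // t s IH; rewrite inE big_cons => /predU1P[->|/IH].
  by rewrite lerDl sumr_ge0.
by move=> /le_trans; apply; rewrite lerDr.
Qed.

Definition mk_linf_cF (f : G -> R) (cf : countable [set g | f g != 0])
  (ff : finite_set (range f)) : V := LinfcF (finite_range_linf_cF f cf ff).

Lemma exists_linf_cF_comp (phi : R -> R) u : phi 0 = 0 ->
  exists v : V, v =1 phi \o u.
Proof.
move=> phi0.
have cv : countable [set g | (phi \o u) g != 0].
  apply: sub_countable (countable_support u); apply: subset_card_le => g /=.
  by apply: contraNneq => ->; rewrite phi0.
have fv : finite_set (range (phi \o u)).
  by rewrite -(image_comp u phi); apply: finite_image; exact: linf_cF_finite.
by exists (mk_linf_cF _ cv fv).
Qed.

Definition signs A : set V :=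
  [set x | forall g, x g \in [:: 0; 1; -1] /\ (A g -> x g = 0)].

Lemma sign_norm_le1 (t : R) : t \in [:: 0; 1; -1] -> `|t| <= 1.
Proof.
by rewrite !inE => /or3P[]/eqP->; rewrite ?normr0 ?normrN ?normr1 ?ler01.
Qed.

Lemma exists_signs A (f : G -> R) : countable [set g | f g != 0] ->
  (forall g, f g \in [:: 0; 1; -1] /\ (A g -> f g = 0)) ->
  exists2 x, signs A x & x =1 f.
Proof.
move=> cf sf; have ff : finite_set (range f).
  apply: (@sub_finite_set _ _ [set` [:: 0; 1; -1 : R]]) => [_ [g _ <-]|].
    by have [] := sf g.
  exact: finite_seq.
by exists (mk_linf_cF f cf ff).
Qed.

Lemma signs0 A : signs A 0.
Proof. by move=> g; split=> //; rewrite inE eqxx. Qed.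

Lemma signsS A A' : A `<=` A' -> signs A' `<=` signs A.
Proof. by move=> AA' x sx g; have [? x0] := sx g; split=> // /AA'. Qed.

Definition extends x y := forall g, x g != 0 -> y g = x g.

Lemma extends_trans x y z : extends x y -> extends y z -> extends x z.
Proof. by move=> xy yz g x0; rewrite yz xy. Qed.

(** On the support of [y] the reflection keeps the common value of [y] and [z]; elsewhere it flips
    the sign of [z]. *)
Lemma signs_reflect A y z : signs A y -> signs A z -> extends y z ->
  signs A (2 *: y - z) /\ extends y (2 *: y - z).
Proof.
move=> sy sz yz.
have E g : (2 *: y - z) g = 2 * y g - z g by [].
split=> g; last by move=> /yz; rewrite E => ->; lra.
rewrite E; have [yg Ay] := sy g; have [zg Az] := sz g.
split; last by move=> Ag; rewrite Ay// Az//; lra.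
have [y0|/yz ->] := eqVneq (y g) 0; last by rewrite (_ : _ - _ = y g)//; lra.
rewrite y0 mulr0 sub0r; move: zg; rewrite !inE => /or3P[]/eqP->.
- by rewrite oppr0 eqxx.
- by rewrite eqxx !orbT.
- by rewrite opprK eqxx !orbT.
Qed.

(** The bound [0 <= M] covers empty [G], where the supremum is 0 by convention. *)
Lemma sup_norm_le x (M : R) : 0 <= M -> (forall g, `|x g| <= M) -> sup_norm x <= M.
Proof.
move=> M0 xM; have [[g _]|nG] := pselect (exists g : G, True).
  by apply: ge_sup; [exists `|x g|, g|move=> _ [h _ <-]].
rewrite /sup_norm (_ : [set `|x g| | g in _] = set0) ?sup0//.
by apply/seteqP; split=> t // [g]; case: nG; exists g.
Qed.

End Vectors.

(** * Norms dominated by the supremum norm *)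

Section Norm.
Context {R : realType} {G : Type} (N : linf_cF R G -> R) (C : R).
Hypothesis N_norm : is_norm N.
Hypothesis C_ge0 : 0 <= C.
Hypothesis N_le : forall x, N x <= C * sup_norm x.
Local Notation V := (linf_cF R G).
Implicit Types (A : set G) (x y z u : V).

Lemma norm0 : N 0 = 0.
Proof. by rewrite -(scale0r (0 : V)) (is_normZ N_norm) normr0 mul0r. Qed.

Lemma normN x : N (- x) = N x.
Proof. by rewrite -scaleN1r (is_normZ N_norm) normrN1 mul1r. Qed.

Lemma norm_reflect x z : 2 * N x <= N z + N (2 *: x - z).
Proof.
have -> : 2 * N x = N (2 *: x) by rewrite (is_normZ N_norm) ger0_norm.
rewrite (le_trans _ (is_normD N_norm _ _))// addrC subrK//.
Qed.

Lemma norm_signs_le A x : signs A x -> N x <= C.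
Proof.
move=> sx; rewrite (le_trans (N_le x))// ler_piMr//.
by apply: sup_norm_le => // g; apply: sign_norm_le1; have [] := sx g.
Qed.

(** Take [y] with norm within [e] of the supremum over all extensions of [x]. Both [z] and
    [2 *: y - z] extend [x], so neither norm exceeds that supremum, and [norm_reflect] turns the
    bound on the second into a lower bound on [N z]. *)
Lemma extension_near_constant A (e : R) x : 0 < e -> signs A x ->
  exists y, [/\ signs A y, extends x y &
    forall z, signs A z -> extends y z -> `|N z - N y| <= e].
Proof.
move=> e0 sx.
pose E : set R := [set N z | z in [set z | signs A z /\ extends x z]].
have supE : has_sup E.
  split; first by exists (N x), x.
  by exists C => _ [z [sz _] <-]; exact: norm_signs_le sz.
have [_ [y [sy xy] <-] Ey] := sup_adherent e0 supE.
exists y; split=> // z sz yz.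
have Ez : N z <= sup E.
  by apply: sup_upper_bound => //; exists z => //; split=> //;
    exact: extends_trans xy yz.
have [s' e'] := signs_reflect _ _ _ sy sz yz.
have Ez' : N (2 *: y - z) <= sup E.
  by apply: sup_upper_bound => //; exists (2 *: y - z) => //; split=> //;
    exact: extends_trans xy e'.
have := norm_reflect y z.
rewrite ler_norml; lra.
Qed.

Lemma extension_constant A : exists2 x, signs A x &
  forall z, signs A z -> extends x z -> N z = N x.
Proof.
have /choice[f fP] (p : nat * V) : exists y, signs A p.2 ->
    [/\ signs A y, extends p.2 y &
    forall z, signs A z -> extends y z -> `|N z - N y| <= p.1.+1%:R^-1].
  have [sp|] := pselect (signs A p.2); last by exists 0.
  have [|y yP] := @extension_near_constant A p.1.+1%:R^-1 _ _ sp; last by exists y.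
  by rewrite invr_gt0 ltr0n.
(* A chain of extensions; stage [n.+1] has tolerance 1/(n+1). *)
pose X := fix X n := if n is m.+1 then f (m, X m) else 0.
have sX n : signs A (X n).
  by elim: n => [|n IH]; [exact: signs0|]; have [] := fP (n, X n) IH.
have XS n : extends (X n) (X n.+1) by have [] := fP (n, X n) (sX n).
have XN n z : signs A z -> extends (X n.+1) z -> `|N z - N (X n.+1)| <= n.+1%:R^-1.
  by have [_ _] := fP (n, X n) (sX n); apply.
have XD n k : extends (X n) (X (n + k)%N).
  elim: k => [|k IH]; first by rewrite addn0.
  by rewrite addnS; apply: extends_trans IH (XS _).
have Xeq m n g : X m g != 0 -> X n g != 0 -> X m g = X n g.
  move=> m0 n0; have [mn|/ltnW nm] := leqP m n.
    by rewrite -(subnKC mn) XD.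
  by rewrite -(subnKC nm) XD.
(* The pointwise limit of the chain: the only nonzero value among the [X n g], or 0 by default. *)
pose xi g := xget 0 [set t | t != 0 /\ exists n, X n g = t].
have xiE n g : X n g != 0 -> xi g = X n g.
  move=> n0; rewrite /xi; case: xgetP => [t _ [t0 [m mt]]|/(_ (X n g))].
    by rewrite -mt in t0 *; exact: Xeq.
  by case; split=> //; exists n.
have xi0 g : xi g != 0 -> exists2 n, X n g != 0 & xi g = X n g.
  rewrite /xi; case: xgetP => [t _ [t0 [m mt]] _|_]; last by rewrite eqxx.
  by exists m; rewrite mt.
have [||x sx xE] := @exists_signs R G A xi.
- apply: (@sub_countable _ _ _ (\bigcup_n support (X n))).
    by apply: subset_card_le => g /xi0[n ? _]; exists n.
  by apply: bigcup_countable => // n _; exact: countable_support.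
- move=> g; have [->|/xi0[n _ ->]] := eqVneq (xi g) 0; last exact: sX.
  by rewrite inE eqxx.
have Xx n : extends (X n) x by move=> g; rewrite xE; exact: xiE.
exists x => // z sz xz; apply/eqP; rewrite -subr_eq0 -normr_le0.
apply/ler_addgt0Pr => e e0; rewrite add0r.
(* Both [x] and [z] extend [X n.+1], so their norms lie within 1/(n+1) < e/2 of its norm. *)
have e20 : 0 < e / 2 by lra.
have := near_infty_natSinv_lt (PosNum e20) => -[n _ /(_ n (leqnn n))] /= ne.
have := XN n x sx (Xx _); have := XN n z sz (extends_trans _ _ _ (Xx _) xz).
move: (n.+1%:R^-1) ne => d ne; rewrite !ler_norml.
by move=> /andP[? ?] /andP[? ?]; apply/andP; split; lra.
Qed.

(** Induction on a list [s] of the values that [u] may take besides 0, 1 and -1; when [s] is empty,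
    [u] is a sign vector. *)
Lemma unit_ball_norm_le A K u : (forall y, signs A y -> N y <= K) ->
  (forall g, `|u g| <= 1) -> (forall g, A g -> u g = 0) -> N u <= K.
Proof.
move=> NK; have [s sE] := (finite_seqP (range u)).1 (linf_cF_finite u).
have : forall g, u g \in [:: 0, 1, -1 & s].
  move=> g; have /= us : [set` s] (u g) by rewrite -sE; exists g.
  by rewrite !inE us !orbT.
elim: s {sE} u => [|t s IH] u us u1 uA.
  by apply: NK => g; split; [exact: us|exact: uA].
(* Once [t] is nonzero, the map [phi] fixes 0, so it preserves countable supports and vanishing on
   [A]. *)
have [t0|t0] := eqVneq t 0.
  apply: IH => // g; have := us g; rewrite !inE t0.
  by case: (u g == 0) => //=.
have [t1|t1] := ltP 1 `|t|.
  apply: IH => // g; have := us g; rewrite !inE.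
  case: eqVneq => //= _; do 2 case: eqP => //= _.
  by case: eqVneq => // ut; have := u1 g; rewrite ut leNgt t1.
(* Moving the value t to 1 or to -1 writes u as a convex combination of two
   vectors with one fewer value. *)
pose phi (a r : R) := if r == t then a else r.
have [|v vE] := @exists_linf_cF_comp R G (phi 1) u.
  by rewrite /phi eq_sym (negbTE t0).
have [|w wE] := @exists_linf_cF_comp R G (phi (-1)) u.
  by rewrite /phi eq_sym (negbTE t0).
have uvw : u = ((1 + t) / 2) *: v + ((1 - t) / 2) *: w.
  apply: linf_cF_ext => g.
  rewrite [RHS](_ : _ = (1 + t) / 2 * v g + (1 - t) / 2 * w g)//.
  by rewrite vE wE /= /phi; case: eqP => [->|_]; lra.
have Nv : N v <= K.
  apply: IH => g; rewrite vE /= /phi; last by move=> /uA ->; rewrite eq_sym (negbTE t0).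
  - case: eqVneq => [_|ut]; first by rewrite !inE eqxx orbT.
    by have := us g; rewrite !inE (negbTE ut).
  - by case: ifP => // _; rewrite normr1.
have Nw : N w <= K.
  apply: IH => g; rewrite wE /= /phi; last by move=> /uA ->; rewrite eq_sym (negbTE t0).
  - case: eqVneq => [_|ut]; first by rewrite !inE eqxx !orbT.
    by have := us g; rewrite !inE (negbTE ut).
  - by case: ifP => // _; rewrite normrN1.
rewrite uvw (le_trans (is_normD N_norm _ _))// !(is_normZ N_norm).
move: t1; rewrite ler_norml => /andP[t1 t2].
rewrite !ger0_norm; [nra|lra|lra].
Qed.

Lemma extremal_norm : exists (M : R) A0, [/\ countable A0,
  forall y, signs A0 y -> N y <= M &
  forall A, countable A -> exists2 x, signs (A0 `|` A) x & N x = M].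
Proof.
pose B : set R :=
  [set K | exists2 A, countable A & forall y, signs A y -> N y <= K].
have B_inf : has_inf B.
  split; first by exists C, set0 => // y; exact: norm_signs_le.
  by exists 0 => K [A _ /(_ 0 (signs0 A))]; apply/le_trans/(is_norm_ge0 N_norm).
have /choice[AK AKP] n : exists AK : set G * R, [/\ countable AK.1,
    forall y, signs AK.1 y -> N y <= AK.2 & AK.2 < inf B + n.+1%:R^-1].
  have n0 : 0 < n.+1%:R^-1 :> R by rewrite invr_gt0 ltr0n.
  by have [K [A cA AK] Kn] := inf_adherent n0 B_inf; exists (A, K).
(* Vectors vanishing on this countable union obey all the bounds [(AK n).2], hence their limit
   [inf B]. *)
pose A0 := \bigcup_n (AK n).1.
have cA0 : countable A0 by apply: bigcup_countable => // n _; have [] := AKP n.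
have NA0 y : signs A0 y -> N y <= inf B.
  move=> sy; apply/ler_addgt0Pr => e e0.
  have [n _ /(_ n (leqnn n)) /= ne] := near_infty_natSinv_lt (PosNum e0).
  have [_ /(_ y) Ny Kn] := AKP n.
  have /Ny : signs (AK n).1 y by apply: signsS sy => g An; exists n.
  by move: (n.+1%:R^-1) ne Kn => d; lra.
exists (inf B), A0; split=> // A cA.
have [x sx xN] := extension_constant (A0 `|` A).
exists x => //; apply/eqP; rewrite eq_le NA0/=; last by apply: signsS sx => g; left.
apply: ge_inf; first by case: B_inf.
(* This set witnesses that [N x] belongs to [B]: sign vectors [y] off it are disjoint from [x]. *)
exists (A0 `|` A `|` support x).
  by apply: countable_setU (countable_support _); exact: countable_setU.
move=> y sy.
have E g : (x + y) g = x g + y g by [].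
have xy : extends x (x + y).
  by move=> g xg; rewrite E; have [_ ->] := sy g; [rewrite addr0|right].
have sxy : signs (A0 `|` A) (x + y).
  move=> g; rewrite E; have [xg xA] := sx g; have [yg yA] := sy g.
  split; last by move=> Ag; rewrite xA// yA ?addr0//; left.
  have [x0|x0] := eqVneq (x g) 0; first by rewrite x0 add0r.
  by rewrite yA ?addr0//; right.
have [s' e'] := signs_reflect _ _ _ sx sxy xy.
have := norm_reflect y (x + y).
(* Reflecting [x + y] through [y] gives [y - x], up to sign the extension [x - y] of [x]. *)
have -> : 2 *: y - (x + y) = - (2 *: x - (x + y)).
  by apply: linf_cF_ext => g;
    rewrite [LHS](_ : _ = 2 * y g - (x g + y g))//
            [RHS](_ : _ = - (2 * x g - (x g + y g)))//; lra.
by rewrite normN (xN _ sxy xy) (xN _ s' e'); lra.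
Qed.

End Norm.

(** * Transfinite recursion along omega_1 *)

Lemma omega1_total (a b : omega1) : omega1_le a b \/ omega1_le b a.
Proof.
have [|c [[]-> cmin]] := @wo_set_nat_min [set val a; val b].
- by exists (val a); left.
- by left; apply: cmin; right.
- by right; apply: cmin; left.
Qed.

Definition omega1_lt (a b : omega1) : Prop := omega1_le a b /\ a <> b.

Lemma omega1_lt_wf : well_founded omega1_lt.
Proof.
move=> a; apply: contrapT => na.
have [|_ [[b nb <-] bmin]] := @wo_set_nat_min (val @` [set x | ~ Acc omega1_lt x]).
  by exists (val a), a.
apply: nb; split=> c [cb]; apply: contra_notP => nc.
by apply/val_inj/wo_set_nat_anti => //; apply: bmin; exists c.
Qed.

(** Recursion applies [F] to the union of the supports of all earlier vectors, which is countable
    because initial segments and supports are. *)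
Lemma exists_disjoint_family (R : realType) (F : set omega1 -> linf_cF R omega1) :
  (forall A, countable A -> forall g, A g -> F A g = 0) ->
  exists X : omega1 -> linf_cF R omega1,
    (forall b, exists2 A, countable A & X b = F A) /\
    (forall a b g, X a g != 0 -> X b g != 0 -> a = b).
Proof.
move=> F0.
pose step b (rec : forall a, omega1_lt a b -> linf_cF R omega1) :=
  F [set g | exists a (ab : omega1_lt a b), rec a ab g != 0].
pose X := Fix omega1_lt_wf _ step.
pose A b := \bigcup_(a in [set a | omega1_lt a b]) support (X a).
have XE b : X b = F (A b).
  (* [Fix_eq] asks that [step] depend only on the pointwise values of [rec]. *)
  rewrite /X Fix_eq => [|{}b f f' ff']; last first.
    by congr F; apply/seteqP; split=> g [a [ab]] /= h; exists a, ab;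
      rewrite ?ff' // -ff'.
  by congr F; apply/seteqP; split=> g; [move=> [a [ab h]]|move=> [a ab h]];
    exists a => //; exists ab.
have cA b : countable (A b).
  apply: bigcup_countable => [|a _]; last exact: countable_support.
  by apply: sub_countable (omega1_segment_countable b); apply: subset_card_le => a [].
exists X; split=> [b|a b g Xa Xb]; first by exists (A b).
wlog ab : a b Xa Xb / omega1_le a b => [h|].
  by have [/h|/h/esym] := omega1_total a b; apply.
apply: contrapT => nab; move/eqP: Xb; rewrite XE; apply; apply: F0 => //.
by exists a.
Qed.

Lemma exists_disjoint_extremal (R : realType) (N : linf_cF R omega1 -> R) (C : R) :
  is_norm N -> 0 <= C -> (forall x, N x <= C * sup_norm x) ->
  exists (M : R) A0 (X : omega1 -> linf_cF R omega1), [/\ 0 < M,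
    forall y, signs A0 y -> N y <= M,
    forall b, signs A0 (X b) /\ N (X b) = M &
    forall a b g, X a g != 0 -> X b g != 0 -> a = b].
Proof.
move=> N_norm C0 NC.
have [M [A0 [cA0 NA0 AM]]] := extremal_norm N C N_norm C0 NC.
have /choice[F FP] A : exists x, countable A -> signs (A0 `|` A) x /\ N x = M.
  have [cA|] := pselect (countable A); last by exists 0.
  by have [x sx Nx] := AM A cA; exists x.
have [|X [XF Xdisj]] := exists_disjoint_family R F.
  by move=> A /FP[sF _] g Ag; have [_ ->] := sF g; last right.
exists M, A0, X; split=> // [|b]; last first.
  have [A /FP[sF NF] ->] := XF b; split=> //.
  by apply: signsS sF => g; left.
(* For [0 < M]: the indicator of a point outside the countable set [A0] is a nonzero sign vector of
   norm at most [M]. *)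
have [g nA0g] : exists g, ~ A0 g.
  apply: contrapT => nA; apply: omega1_uncountable.
  apply: sub_countable cA0; apply: subset_card_le => g _.
  by apply: contrapT => nAg; apply: nA; exists g.
pose f h : R := (h == g)%:R.
have [||e se eE] := @exists_signs R omega1 A0 f.
- apply: sub_countable (countable1 g); apply: subset_card_le => h /=.
  by rewrite /f pnatr_eq0 eqb0 negbK => /eqP.
- move=> h; rewrite /f; case: eqP => [->|_]; first by rewrite !inE eqxx orbT.
  by rewrite inE eqxx.
apply: lt_le_trans (NA0 _ se); rewrite lt0r (is_norm_ge0 N_norm) andbT.
apply/eqP => /(is_norm_eq0 N_norm) e0; have := eE g.
by rewrite /f eqxx e0 => /eqP; rewrite eq_sym oner_eq0.
Qed.

(** * Linear combinations of a disjoint family *)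

Section Synthesis.
Context {R : realType} {G : Type} (X : G -> linf_cF R G) (p : G -> G).
Hypothesis X_signs : forall b, signs set0 (X b).
Local Notation V := (linf_cF R G).

(* The sum of the x b *: X b, b in G, when the X b are disjoint and p g is the
   only index b such that X b g may be nonzero. *)
Let synth_fun (x : V) g := x (p g) * X (p g) g.

Lemma synth_countable (x : V) : countable [set g | synth_fun x g != 0].
Proof.
apply: (@sub_countable _ _ _ (\bigcup_(b in support x) support (X b))).
  apply: subset_card_le => g /=; rewrite mulf_eq0 negb_or => /andP[xg Xg].
  by exists (p g).
by apply: bigcup_countable => [|b _]; exact: countable_support.
Qed.

Lemma synth_finite (x : V) : finite_set (range (synth_fun x)).
Proof.
apply: (@finite_image11 G R R R setT *%R (x \o p) (fun g => X (p g) g)).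
  by apply: sub_finite_set (linf_cF_finite x) => _ [g _ <-]; exists (p g).
apply: (@sub_finite_set _ _ [set` [:: 0; 1; -1 : R]]) => [_ [g _ <-]|].
  by have [] := X_signs (p g) g.
exact: finite_seq.
Qed.

Definition synth (x : V) : V := mk_linf_cF _ (synth_countable x) (synth_finite x).

Lemma synthE x g : synth x g = x (p g) * X (p g) g. Proof. by []. Qed.

Lemma synth_linear : linear synth.
Proof.
move=> c x y; apply: linf_cF_ext => g.
rewrite [RHS](_ : _ = c * synth x g + synth y g)// !synthE mulrA -mulrDl.
by [].
Qed.

HB.instance Definition _ :=
  GRing.isLinear.Build R V V *:%R synth synth_linear.

End Synthesis.

(** * The isometry *)

Theorem theoremC (R : realType) (N : linf_cF R omega1 -> R)
    (N_norm : is_norm N)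
    (N_equiv : equivalent_norms N (@sup_norm R omega1)) :
  exists J : {linear linf_cF R omega1 -> linf_cF R omega1},
    forall x : linf_cF R omega1, N (J x) = sup_norm x.
Proof.
have [c [C [_ /ltW C0 NC]]] := N_equiv.
have [M [A0 [X [M0 NA0 XN Xdisj]]]] :=
  exists_disjoint_extremal R N C N_norm C0 (fun x => (NC x).2).
(* Where all [X b] vanish, the index is arbitrary; [g] itself is taken. *)
have /choice[p pX] g : exists b, forall a, X a g != 0 -> a = b.
  have [[b Xb]|nX] := pselect (exists b, X b g != 0).
    by exists b => a Xa; exact: Xdisj Xa Xb.
  by exists g => a Xa; case: nX; exists a.
have Xs b : signs set0 (X b) by apply: signsS (XN b).1.
pose T : {linear linf_cF R omega1 -> linf_cF R omega1} :=
  synth X p Xs.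
exists (M^-1 \*: T) => x.
rewrite [X in N X](_ : _ = M^-1 *: T x)//.
have TE y g : T y g = y (p g) * X (p g) g by exact: synthE.
set S := sup_norm x; have xS b : `|x b| <= S := sup_norm_ub x b.
have [S0|S_neq0] := eqVneq S 0.
  by rewrite S0 (is_norm_eq0 (sup_norm_is_norm _ _) S0) linear0 scaler0 (norm0 N).
have S_gt0 : 0 < S.
  by rewrite lt0r S_neq0 (is_norm_ge0 (sup_norm_is_norm _ _)).
rewrite (is_normZ N_norm) gtr0_norm ?invr_gt0//.
(* Domination by the [X b] puts [u / S] in the unit ball and also makes it vanish on [A0]. *)
have ball (u : linf_cF R omega1) :
    (forall g, `|u g| <= S * `|X (p g) g|) -> N u <= S * M.
  move=> uS; rewrite -ler_pdivrMl// -{1}(gtr0_norm S_gt0) -normfV -(is_normZ N_norm).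
  apply: (unit_ball_norm_le N N_norm A0) => // g.
    rewrite [X in `|X|](_ : _ = S^-1 * u g)// normrM normfV (gtr0_norm S_gt0).
    rewrite ler_pdivrMl// mulr1 (le_trans (uS g))// ler_piMr ?(ltW S_gt0)//.
    by apply: sign_norm_le1; have [] := Xs (p g) g.
  move=> Ag; rewrite [LHS](_ : _ = S^-1 * u g)//.
  have := uS g; have [_ /(_ Ag) ->] := (XN (p g)).1 g.
  by rewrite normr0 mulr0 normr_le0 => /eqP ->; rewrite mulr0.
have TxS : N (T x) <= S * M.
  by apply: ball => g; rewrite TE normrM ler_wpM2r.
rewrite mulrC; apply/eqP; rewrite eq_le ler_pdivrMr// TxS /= ler_pdivlMr//.
have reflected b : 2 * (`|x b| * M) <= N (T x) + S * M.
  have := norm_reflect N N_norm (x b *: X b) (T x).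
  rewrite (is_normZ N_norm) (XN b).2 => /le_trans; apply; rewrite lerD2l.
  (* The reflection keeps [T x] on the support of [X b] and negates it elsewhere, so the same
     domination holds. *)
  apply: ball => g.
  rewrite [X in `|X|](_ : _ = 2 * (x b * X b g) - x (p g) * X (p g) g)//.
  have [Xb0|/[dup] Xb /pX bp] := eqVneq (X b g) 0.
    by rewrite Xb0 !mulr0 sub0r normrN normrM ler_wpM2r.
  by rewrite -bp mulr_natl mulr2n addrK normrM ler_wpM2r.
set d := N (T x) / M; have dM : d * M = N (T x) by rewrite divfK// gt_eqF.
have d0 : 0 <= d by rewrite divr_ge0 ?(is_norm_ge0 N_norm) ?ltW.
(* Dividing [reflected] by [2 * M] bounds every [|x b|] by (d + S)/2; the supremum over [b] then
   gives [S <= d]. *)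
have : S <= (d + S) / 2.
  apply: sup_norm_le => [|b]; first by lra.
  by rewrite -(ler_pM2r M0); have := reflected b; rewrite -dM; lra.
rewrite -dM ler_pM2r//; lra.
Qed.
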